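(* Let $\Psi^*$ be an arbitrary canonical spectral measure on the unit simplex $\Sigma^d$, and let $$\Psi^*_0:=\sum_{i=1}^d\delta_{e_i},\qquad \Psi^*_1:=d\cdot\delta_{(1/d,\dots,1/d)},$$ where $e_i$ is the $i$-th unit vector of $\mathbb{R}^d$ and $\delta_x$ is the Dirac measure at $x$. Then (a) $\Psi^*_0\preceq_{\mathcal{G}_\alpha}\Psi^*\preceq_{\mathcal{G}_\alpha}\Psi^*_1$ for $\alpha\ge 1$; (b) $\Psi^*_1\preceq_{\mathcal{G}_\alpha}\Psi^*\preceq_{\mathcal{G}_\alpha}\Psi^*_0$ for $\alpha\in(0,1]$.
   Context: $\Sigma^d:=\{\xi\in[0,\infty)^d:\sum_i\xi^{(i)}=1\}$, where $x^{(i)}$ denotes the $i$-th component of $x$. A canonical spectral measure on $\Sigma^d$ (the standardized spectral measure, with respect to the $\ell^1$-norm, of a multivariate regularly varying random vector whose spectral measure is concentrated on $\Sigma^d$) is a finite Borel measure $\Psi^*$ on $\Sigma^d$ with $\int_{\Sigma^d}s^{(i)}\,d\Psi^*(s)=1$ for $i=1,\dots,d$. For $\alpha>0$, $\xi\in\Sigma^d$ and $s\in\Sigma^d$ let $g_{\xi,\alpha}(s):=\Bigl(\sum_{i=1}^d\xi^{(i)}(s^{(i)})^{1/\alpha}\Bigr)^{\alpha}$. For two canonical spectral measures on $\Sigma^d$, $\Psi^*\preceq_{\mathcal{G}_\alpha}\Phi^*$ means $\int g_{\xi,\alpha}\,d\Psi^*\le\int g_{\xi,\alpha}\,d\Phi^*$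 for all $\xi\in\Sigma^d$. *)

(* Defs.v *)
From HB Require Import structures.
From mathcomp Require Import all_boot all_order all_algebra.
From mathcomp Require Import all_classical all_reals all_analysis measurable_realfun.
Import Order.TTheory GRing.Theory Num.Theory numFieldNormedType.Exports.

Set Implicit Arguments.
Unset Strict Implicit.
Unset Printing Implicit Defensive.

Local Open Scope classical_set_scope.
Local Open Scope ring_scope.

Definition simplex (R : realType) (d : nat) : set 'rV[R]_d :=
  [set x | (forall i, 0 <= x 0 i) /\ \sum_i x 0 i = 1].

Lemma simplex_unit_vector (R : realType) (d : nat) (i : 'I_d) :
  simplex (delta_mx 0 i : 'rV[R]_d).
Proof.
split=> [j|]; first by rewrite mxE ler0n.
rewrite (bigD1 i)//= mxE !eqxx big1 ?addr0// => j /negPf ji.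
by rewrite mxE ji andbF.
Qed.

Lemma simplex_barycenter (R : realType) (n : nat) :
  simplex (const_mx (n.+1%:R^-1) : 'rV[R]_n.+1).
Proof.
split=> [j|]; first by rewrite mxE invr_ge0 ler0n.
under eq_bigr do rewrite mxE.
by rewrite sumr_const card_ord -[LHS]mulr_natr mulVf ?pnatr_eq0.
Qed.

(* A measurable type has to be inhabited, hence the dimension n.+1. The
   topology on the subtype is the one induced by that of 'rV[R]_n.+1. *)
Definition Sigma (R : realType) (n : nat) : Type := set_type (@simplex R n.+1).

HB.instance Definition _ (R : realType) (n : nat) :=
  Topological.on (Sigma R n).

Definition unit_vector (R : realType) (n : nat) (i : 'I_n.+1) : Sigma R n :=
  exist _ (delta_mx 0 i) (mem_set (simplex_unit_vector R i)).

Definition barycenter (R : realType) (n : nat) : Sigma R n :=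
  exist _ (const_mx (n.+1%:R^-1)) (mem_set (simplex_barycenter R n)).

HB.instance Definition _ (R : realType) (n : nat) :=
  isPointed.Build (Sigma R n) (barycenter R n).

Definition SigmaBorel (R : realType) (n : nat) :=
  g_sigma_algebraType (@open (Sigma R n)).

Definition scoord (R : realType) (n : nat) (s : Sigma R n) (i : 'I_n.+1) : R :=
  \val s 0 i.

Record canonicalSpectralMeasure (R : realType) (n : nat) := CanonicalSpectral {
  csm_measure :> {finite_measure set (SigmaBorel R n) -> \bar R} ;
  csm_mean : forall i : 'I_n.+1, (\int[csm_measure]_s (scoord s i)%:E = 1)%E }.

Definition gfun (R : realType) (n : nat) (xi : Sigma R n) (alpha : R)
    (s : Sigma R n) : R :=
  (\sum_i scoord xi i * scoord s i `^ alpha^-1) `^ alpha.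

Definition preceq_G (R : realType) (n : nat) (alpha : R)
    (Psi Phi : canonicalSpectralMeasure R n) : Prop :=
  forall xi : Sigma R n,
    (\int[Psi]_s (gfun xi alpha s)%:E <= \int[Phi]_s (gfun xi alpha s)%:E)%E.

Section extremal_measures.
Variables (R : realType) (n : nat).

Lemma measurable_scoord i :
  measurable_fun [set: SigmaBorel R n] (fun s : SigmaBorel R n => scoord s i).
Proof.
apply: (measurability _ (RGenOpens.measurableE R)) => _ [_ [a [b ->]] <-].
rewrite setTI; apply: sub_sigma_algebra.
have : continuous (fun s : Sigma R n => scoord s i).
  move=> s; apply: (@continuous_comp _ _ _ set_val (fun x : 'rV[R]_n.+1 => x 0 i)).
    exact: initial_continuous.
  exact: coord_continuous.
by move/continuousP; apply; exact: interval_open.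
Qed.

Lemma scoord_ge0 (s : Sigma R n) i : 0 <= scoord s i.
Proof. by have [/(_ i)] := set_mem (valP s). Qed.

(* msum sums a sequence of measures indexed by nat; inord is the identity on
   the indices < n.+1 that are used. *)
Definition Psi0_measure : set (SigmaBorel R n) -> \bar R :=
  msum (fun k => \d_(unit_vector R (inord k : 'I_n.+1) : SigmaBorel R n)) n.+1.

HB.instance Definition _ := Measure.on Psi0_measure.

Lemma Psi0_finite : fin_num_fun Psi0_measure.
Proof. by move=> A mA; apply/sum_fin_numP => i _ _; rewrite /= /dirac indicE. Qed.

HB.instance Definition _ :=
  @Measure_isFinite.Build _ _ _ Psi0_measure Psi0_finite.

Lemma Psi0_mean i : (\int[Psi0_measure]_s (scoord s i)%:E = 1)%E.
Proof.
rewrite ge0_integral_measure_sum//; last 2 first.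
- by move=> s _; rewrite lee_fin scoord_ge0.
- by apply/measurable_EFinP; exact: measurable_scoord.
under eq_bigr => k _.
  rewrite integral_dirac//; last by apply/measurable_EFinP; exact: measurable_scoord.
  rewrite diracT mul1e /scoord /= inord_val mxE eqxx /=.
  over.
rewrite sumEFin (bigD1 i)//= eqxx big1 ?addr0// => k /negPf.
by rewrite eq_sym => ->.
Qed.

Definition Psi0 : canonicalSpectralMeasure R n :=
  @CanonicalSpectral R n Psi0_measure Psi0_mean.

Definition Psi1_measure : set (SigmaBorel R n) -> \bar R :=
  mscale (n.+1%:R)%:nng (\d_(barycenter R n : SigmaBorel R n)).

HB.instance Definition _ := FiniteMeasure.on Psi1_measure.

Lemma Psi1_mean i : (\int[Psi1_measure]_s (scoord s i)%:E = 1)%E.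
Proof.
have mE : measurable_fun [set: SigmaBorel R n]
    (fun s : SigmaBorel R n => (scoord s i)%:E).
  by apply/measurable_EFinP; exact: measurable_scoord.
rewrite ge0_integral_mscale//; last first.
  by move=> s _; rewrite lee_fin scoord_ge0.
rewrite integral_dirac// diracT mul1e /scoord /= mxE -EFinM mulfV//.
Qed.

Definition Psi1 : canonicalSpectralMeasure R n :=
  @CanonicalSpectral R n Psi1_measure Psi1_mean.

End extremal_measures.

(* Main.v *)
(** Write [g] for [gfun xi alpha]. For [alpha >= 1], superadditivity of
    [t `^ alpha] and Jensen's inequality sandwich [g] between two linear forms:
    [\sum_i xi_i `^ alpha * s_i <= g s <= \sum_i xi_i * s_i];
    for [alpha <= 1] both inequalities are reversed. The moment conditions
    force a linear form to have the same integral, the sum of its coefficients,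
    against every canonical spectral measure. These values are attained by [g]
    itself: [\sum_i xi_i `^ alpha] at [Psi0] and [\sum_i xi_i = 1] at [Psi1]. *)
Require Import Defs.
From mathcomp Require Import all_boot all_order all_algebra.
From mathcomp Require Import all_classical all_reals all_analysis.
From mathcomp Require Import measurable_realfun.
Import Order.TTheory GRing.Theory Num.Theory.
Local Open Scope ring_scope.

Section power_inequalities.
Context {R : realType} {I : finType}.
Implicit Types (w x : I -> R) (p a b : R).

Lemma powRVK p a : p != 0 -> 0 <= a -> (a `^ p^-1) `^ p = a.
Proof. by move=> p0 a0; rewrite -powRrM mulVf ?powRr1. Qed.

(** Moves an exponent across an inequality, so that bounds for exponents [a <= 1] follow from
    convexity at [a^-1 >= 1]. *)
Lemma le_powRV p a b : 0 < p -> 0 <= a -> 0 <= b ->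
  (a `^ p^-1 <= b) = (a <= b `^ p).
Proof.
move=> p0 a0 b0; apply/idP/idP => ab.
  rewrite -(@powRVK p a) ?gt_eqF//.
  by rewrite ge0_ler_powR ?nnegrE ?powR_ge0// ltW.
rewrite -[leRHS](@powRVK p^-1) ?invr_eq0 ?gt_eqF// invrK.
by rewrite ge0_ler_powR ?nnegrE ?powR_ge0// invr_ge0 ltW.
Qed.

(** With S the sum, S^p is the sum of the x_i S^(p-1), and x_i^(p-1) <= S^(p-1) because x_i <= S and
    p - 1 >= 0. *)
Lemma sum_powR_le p x : 1 <= p -> (forall i, 0 <= x i) ->
  \sum_i x i `^ p <= (\sum_i x i) `^ p.
Proof.
move=> p1 x0; have p0 : 0 < p by exact: lt_le_trans p1.
rewrite -mulr_powRB1 ?sumr_ge0// mulr_suml ler_sum// => i _.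
rewrite -mulr_powRB1// ler_wpM2l// ge0_ler_powR ?subr_ge0 ?nnegrE ?sumr_ge0//.
by rewrite (bigD1 i)//= lerDl sumr_ge0.
Qed.

Lemma jensen_powR p w x : 1 <= p -> (forall i, 0 <= w i) ->
  \sum_i w i = 1 -> (forall i, 0 <= x i) ->
  (\sum_i w i * x i) `^ p <= \sum_i w i * x i `^ p.
Proof.
rewrite le_eqVlt => /predU1P[<-|p1] w0 w1 x0.
  (* The case [p = 1] is separate: it has no finite conjugate exponent for Young's inequality. *)
  rewrite powRr1 ?sumr_ge0// => [|i _]; last by rewrite mulr_ge0.
  by rewrite ler_sum// => i _; rewrite powRr1.
have p0 : 0 < p by exact: lt_trans p1.
set m := \sum_i _; have m0 : 0 <= m by rewrite sumr_ge0// => i _; rewrite mulr_ge0.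
(* Young's inequality, i.e. the tangent line of [t `^ p] at the mean [m]. *)
have young i : x i * m `^ (p - 1) <= x i `^ p / p + m `^ p * (1 - p^-1).
  (* The conjugate exponent is q = p / (p - 1), chosen so that (m^(p-1))^q = m^p. *)
  have := @conjugate_powR _ (x i) (m `^ (p - 1)) p (p / (p - 1)).
  rewrite -powRrM mulrCA divff ?subr_eq0 ?gt_eqF// mulr1 invf_div.
  rewrite mulrBl divff ?gt_eqF// mul1r; apply; rewrite ?powR_ge0//.
    by rewrite divr_gt0// subr_gt0.
  by rewrite addrC subrK.
(* Averaging with the weights [w] turns the left side into m^p; cancelling m^p leaves the claim
   divided by p. *)
have : m * m `^ (p - 1) <=
    \sum_i w i * x i `^ p / p + \sum_i w i * (m `^ p * (1 - p^-1)).
  rewrite mulr_suml -big_split/= ler_sum// => i _.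
  by rewrite -!mulrA -mulrDr ler_wpM2l.
rewrite mulr_powRB1// -!mulr_suml w1 mul1r mulrBr mulr1 addrCA lerDl -mulrBl.
by rewrite pmulr_lge0 ?invr_gt0// subr_ge0.
Qed.

End power_inequalities.

Section gfun_bounds.
Context {R : realType} {n : nat}.
Implicit Types (xi s : Sigma R n) (a : R).

Lemma scoord_sum s : \sum_i scoord s i = 1.
Proof. by have [] := set_mem (valP s). Qed.

Lemma gfun_ge0 xi a s : 0 <= gfun xi a s.
Proof. exact: powR_ge0. Qed.

Lemma wsum_ge0 (c : 'I_n.+1 -> R) s : (forall i, 0 <= c i) ->
  0 <= \sum_i c i * scoord s i.
Proof. by move=> c0; rewrite sumr_ge0// => i _; rewrite mulr_ge0// scoord_ge0. Qed.

(** Superadditivity for the terms xi_i s_i^(1/a), whose a-th powers are xi_i^a s_i. *)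
Lemma gfun_ge1_lower a xi s : 1 <= a ->
  \sum_i scoord xi i `^ a * scoord s i <= gfun xi a s.
Proof.
move=> a1; have a0 : a != 0 by rewrite gt_eqF// (lt_le_trans _ a1).
apply: le_trans (sum_powR_le _ _ _ _) => // [|i]; last first.
  by rewrite mulr_ge0 ?powR_ge0 ?scoord_ge0.
by rewrite ler_sum// => i _; rewrite powRM ?powR_ge0 ?scoord_ge0// powRVK ?scoord_ge0.
Qed.

(** Jensen at the points s_i^(1/a), with the coordinates of [xi] as weights. *)
Lemma gfun_ge1_upper a xi s : 1 <= a ->
  gfun xi a s <= \sum_i scoord xi i * scoord s i.
Proof.
move=> a1; have a0 : a != 0 by rewrite gt_eqF// (lt_le_trans _ a1).
apply: le_trans (jensen_powR _ _ _ _ _ _ _) _; rewrite ?scoord_sum//;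
  try by move=> i; rewrite ?powR_ge0 ?scoord_ge0.
by rewrite ler_sum// => i _; rewrite powRVK ?scoord_ge0.
Qed.

Lemma gfun_le1_lower a xi s : 0 < a <= 1 ->
  \sum_i scoord xi i * scoord s i <= gfun xi a s.
Proof.
move=> /andP[a0 a1]; rewrite -le_powRV//.
(* Jensen now has exponent [a^-1] and is applied to the s_i themselves. *)
- by apply: jensen_powR; rewrite ?scoord_sum ?invf_ge1//; exact: scoord_ge0.
- by apply: wsum_ge0; exact: scoord_ge0.
- by rewrite sumr_ge0// => i _; rewrite mulr_ge0 ?powR_ge0 ?scoord_ge0.
Qed.

Lemma gfun_le1_upper a xi s : 0 < a <= 1 ->
  gfun xi a s <= \sum_i scoord xi i `^ a * scoord s i.
Proof.
move=> /andP[a0 a1]; have b0 : 0 < a^-1 by rewrite invr_gt0.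
(* Reading the outer exponent as the inverse of [a^-1] reduces the goal to superadditivity at [a^-1]
   for the terms xi_i^a s_i. *)
rewrite /gfun -{2}[a]invrK le_powRV//.
- apply: le_trans (sum_powR_le _ _ _ _); rewrite ?invf_ge1//; last first.
    by move=> i; rewrite mulr_ge0 ?powR_ge0 ?scoord_ge0.
  rewrite ler_sum// => i _; rewrite powRM ?powR_ge0 ?scoord_ge0//.
  by rewrite -{2}[a]invrK powRVK ?scoord_ge0// gt_eqF.
- by rewrite sumr_ge0// => i _; rewrite mulr_ge0 ?powR_ge0 ?scoord_ge0.
- by apply: wsum_ge0 => i; exact: powR_ge0.
Qed.

End gfun_bounds.

Section integrals.
Context {R : realType} {n : nat}.
Implicit Types (xi : Sigma R n) (a : R) (c : 'I_n.+1 -> R).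
Implicit Type Psi : canonicalSpectralMeasure R n.
Local Notation T := (SigmaBorel R n).

Lemma measurable_gfun xi a : measurable_fun [set: T] (gfun xi a).
Proof.
apply: (@measurableT_comp _ _ _ _ _ _ (@powR R ^~ a)) => //.
apply: measurable_sum => i; apply: measurable_funM => //.
apply: (@measurableT_comp _ _ _ _ _ _ (@powR R ^~ a^-1)) => //.
exact: measurable_scoord.
Qed.

Lemma measurable_wsum c :
  measurable_fun [set: T] (fun s => \sum_i c i * scoord s i).
Proof.
by apply: measurable_sum => i; apply: measurable_funM => //; exact: measurable_scoord.
Qed.

(** The moment conditions enter only here; the value does not depend on [Psi], which makes different
    measures comparable. *)
Lemma integral_wsum Psi c : (forall i, 0 <= c i) ->
  (\int[Psi]_s (\sum_i c i * scoord s i)%:E = (\sum_i c i)%:E)%E.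
Proof.
move=> c0; under eq_integral do rewrite -sumEFin.
have mc i : measurable_fun [set: T] (fun s => (scoord s i)%:E).
  by apply/measurable_EFinP; exact: measurable_scoord.
rewrite ge0_integral_sum//.
- rewrite -sumEFin; apply: eq_bigr => i _.
  under eq_integral do rewrite EFinM.
  rewrite ge0_integralZl_EFin// ?csm_mean ?mule1// => s _.
  by rewrite lee_fin scoord_ge0.
- move=> i; apply/measurable_EFinP/measurable_funM => //.
  exact: measurable_scoord.
- by move=> i s _; rewrite lee_fin mulr_ge0 ?scoord_ge0.
Qed.

Lemma le_integral_gfun_wsum Psi xi a c : (forall i, 0 <= c i) ->
  (forall s, gfun xi a s <= \sum_i c i * scoord s i) ->
  (\int[Psi]_s (gfun xi a s)%:E <= (\sum_i c i)%:E)%E.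
Proof.
move=> c0 gc; rewrite -(integral_wsum Psi)//.
apply: ge0_le_integral => // [s _|||s _].
- by rewrite lee_fin gfun_ge0.
- by apply/measurable_EFinP; exact: measurable_gfun.
- by apply/measurable_EFinP; exact: measurable_wsum.
- by rewrite lee_fin.
Qed.

Lemma ge_integral_gfun_wsum Psi xi a c : (forall i, 0 <= c i) ->
  (forall s, \sum_i c i * scoord s i <= gfun xi a s) ->
  ((\sum_i c i)%:E <= \int[Psi]_s (gfun xi a s)%:E)%E.
Proof.
move=> c0 cg; rewrite -(integral_wsum Psi)//.
apply: ge0_le_integral => // [s _|||s _].
- by rewrite lee_fin wsum_ge0.
- by apply/measurable_EFinP; exact: measurable_wsum.
- by apply/measurable_EFinP; exact: measurable_gfun.
- by rewrite lee_fin.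
Qed.

Lemma gfun_unit_vector xi a i : a != 0 ->
  gfun xi a (unit_vector R i) = scoord xi i `^ a.
Proof.
move=> a0; rewrite /gfun (bigD1 i)//= big1 => [|j ji].
  by rewrite {2}/scoord/= mxE !eqxx powR1 mulr1 addr0.
(* The other terms vanish because [a^-1] is nonzero; by convention 0 to the power 0 is 1. *)
by rewrite [X in X `^ _]/scoord/= mxE (negbTE ji) andbF powR0 ?mulr0// invr_eq0.
Qed.

Lemma gfun_barycenter xi a : a != 0 -> gfun xi a (barycenter R n) = n.+1%:R^-1.
Proof.
move=> a0; rewrite /gfun.
under eq_bigr do rewrite [X in _ * X `^ _]/scoord/= mxE.
by rewrite -mulr_suml scoord_sum mul1r powRVK// invr_ge0.
Qed.

Lemma integral_gfun_Psi0 xi a : a != 0 ->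
  (\int[Psi0 R n]_s (gfun xi a s)%:E = (\sum_i scoord xi i `^ a)%:E)%E.
Proof.
move=> a0; have mg : measurable_fun [set: T] (EFin \o gfun xi a).
  by apply/measurable_EFinP; exact: measurable_gfun.
rewrite ge0_integral_measure_sum//; last by move=> s _; rewrite lee_fin gfun_ge0.
rewrite -sumEFin; apply: eq_bigr => i _.
by rewrite integral_dirac// diracT mul1e inord_val gfun_unit_vector.
Qed.

Lemma integral_gfun_Psi1 xi a : a != 0 ->
  (\int[Psi1 R n]_s (gfun xi a s)%:E = 1)%E.
Proof.
move=> a0; have mg : measurable_fun [set: T] (EFin \o gfun xi a).
  by apply/measurable_EFinP; exact: measurable_gfun.
rewrite ge0_integral_mscale//; last by move=> s _; rewrite lee_fin gfun_ge0.
by rewrite integral_dirac// diracT mul1e gfun_barycenter// -EFinM mulfV/= ?pnatr_eq0.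
Qed.

End integrals.

Theorem theorem3p7 (R : realType) (n : nat)
    (Psi : canonicalSpectralMeasure R n) :
  (forall alpha : R, 1 <= alpha ->
     preceq_G alpha (Psi0 R n) Psi /\ preceq_G alpha Psi (Psi1 R n)) /\
  (forall alpha : R, 0 < alpha <= 1 ->
     preceq_G alpha (Psi1 R n) Psi /\ preceq_G alpha Psi (Psi0 R n)).
Proof.
split=> a a1.
  have a0 : a != 0 by rewrite gt_eqF// (lt_le_trans _ a1).
  split=> xi.
    rewrite integral_gfun_Psi0// ge_integral_gfun_wsum// => [i|s].
      exact: powR_ge0.
    exact: gfun_ge1_lower.
  (* The value 1 is rewritten as the sum of the coordinates of [xi], the coefficients of the linear
     bound. *)
  rewrite integral_gfun_Psi1// -(scoord_sum xi) le_integral_gfun_wsum// => [i|s].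
    exact: scoord_ge0.
  exact: gfun_ge1_upper.
have a0 : a != 0 by case/andP: a1 => a0 _; rewrite gt_eqF.
split=> xi.
  rewrite integral_gfun_Psi1// -(scoord_sum xi) ge_integral_gfun_wsum// => [i|s].
    exact: scoord_ge0.
  exact: gfun_le1_lower.
rewrite integral_gfun_Psi0// le_integral_gfun_wsum// => [i|s].
  exact: powR_ge0.
exact: gfun_le1_upper.
Qed.
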